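(* Let $F\in\mathbb C[x,y,s,t]$, and let $G\in\mathbb C[x,y]\setminus\mathbb C$ and $K\in\mathbb C[s,t]\setminus\mathbb C$ be squarefree. Then $Z(G)\times Z(K)\subset Z(F)$ if and only if $F$ is $(G,K)$-Cartesian.
   Context: $Z(\cdot)$ denotes the complex zero set; $Z(G)\subset\mathbb C^2$ in coordinates $(x,y)$, $Z(K)\subset\mathbb C^2$ in coordinates $(s,t)$, and $Z(F)\subset\mathbb C^4$. A polynomial is squarefree if it has no repeated irreducible factors. $F$ is $(G,K)$-Cartesian if $F=G(x,y)H(x,y,s,t)+K(s,t)L(x,y,s,t)$ for some $H,L\in\mathbb C[x,y,s,t]$. *)

(* Defs.v *)
(* The complex numbers are modelled as R[i] = complex R for
   an arbitrary R : realType (any realType is the field of real numbers, so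
   R[i] is the field C).  Multivariate polynomials use multinomials' mpoly. *)
From HB Require Import structures.
From mathcomp Require Import all_boot all_order all_algebra.
From mathcomp Require Import reals.
From mathcomp Require Import complex.
From mathcomp Require Import mpoly.
Set Implicit Arguments.
Unset Strict Implicit.
Unset Printing Implicit Defensive.
Import GRing.Theory.
Local Open Scope ring_scope.

Section Defs.
Context {F : fieldType} {n : nat}.

Definition mconst (p : {mpoly F[n]}) : Prop := exists c : F, p = c%:MP.

Definition mdvd (p q : {mpoly F[n]}) : Prop := exists r : {mpoly F[n]}, q = r * p.

(* irreducible polynomial: non-constant and not a product of two non-constants
   (the units of F[X] are exactly the nonzero constants) *)
Definition mirreducible (p : {mpoly F[n]}) : Prop :=
  ~ mconst p /\ forall a b : {mpoly F[n]}, p = a * b -> mconst a \/ mconst b.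

Definition msquarefree (p : {mpoly F[n]}) : Prop :=
  forall q : {mpoly F[n]}, mirreducible q -> ~ mdvd (q * q) p.
End Defs.

(* Coordinates of C^4: x = X_0, y = X_1, s = X_2, t = X_3. *)
Definition liftG {F : fieldType} (G : {mpoly F[2]}) : {mpoly F[4]} :=
  G \mPo [tuple 'X_0; 'X_1].
Definition liftK {F : fieldType} (K : {mpoly F[2]}) : {mpoly F[4]} :=
  K \mPo [tuple 'X_2; 'X_3].

Definition cartesian {F : fieldType} (P : {mpoly F[4]}) (G K : {mpoly F[2]}) : Prop :=
  exists H L : {mpoly F[4]}, P = liftG G * H + liftK K * L.

Definition zero_set {F : fieldType} {n : nat} (p : {mpoly F[n]}) (v : n.-tuple F) : Prop :=
  p.@[tnth v] = 0.

(* Main.v *)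
(** Write F = sum_i a_i(x,y) b_i(s,t). At a zero v of G the polynomial
    sum_i a_i(v) b_i vanishes on Z(K), hence is a multiple of K by the
    Nullstellensatz for the squarefree plane curve K. If a_1(v) <> 0 for some such
    v, this expresses b_1 modulo K through the other b_i and one term of the sum
    can be eliminated modulo K; otherwise G divides a_1, by the Nullstellensatz
    for G, and the term can be dropped modulo G.

    The Nullstellensatz for plane curves reduces to an irreducible q. If q involves
    the second variable and does not divide p, then Gauss's lemma and Bezout over
    F(x) give u q + v p = d(x) <> 0; over a generic x the curve q = 0 has a point
    where d(x) <> 0, so p does not vanish there. *)
Require Import Defs.
From HB Require Import structures.
From mathcomp Require Import all_boot all_order all_algebra.
From mathcomp Require Import boolp reals complex mpoly.
Set Implicit Arguments.
Unset Strict Implicit.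
Unset Printing Implicit Defensive.
Import GRing.Theory.
Local Open Scope ring_scope.

(** * The isomorphism of F[x, y] with F[x][y] *)

Section BivariateIsomorphism.
Variable F : fieldType.
Implicit Types (p : {mpoly F[2]}) (P : {poly {poly F}}).

(* The first coordinate becomes the inner variable, the second the outer one. *)
Definition bivar p : {poly {poly F}} :=
  mmap (polyC \o polyC) (tnth [tuple 'X%:P; 'X]) p.

Fact bivar_is_zmod_morphism : zmod_morphism bivar.
Proof. exact: mmap_is_additive. Qed.

Fact bivar_is_monoid_morphism : monoid_morphism bivar.
Proof.
have [bivarM bivar1] : GRing.multiplicative bivar.
  exact: mmap_is_multiplicative.
by split.
Qed.

HB.instance Definition _ := GRing.isZmodMorphism.Build {mpoly F[2]} {poly {poly F}}
  bivar bivar_is_zmod_morphism.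

HB.instance Definition _ := GRing.isMonoidMorphism.Build {mpoly F[2]} {poly {poly F}}
  bivar bivar_is_monoid_morphism.

Definition unbivar P : {mpoly F[2]} :=
  (map_poly (fun c : {poly F} => (map_poly (@mpolyC 2 F) c).['X_0]) P).['X_1].

Fact inner_comm : commr_rmorph (@mpolyC 2 F) 'X_0.
Proof. by move=> c; apply: mulrC. Qed.

Fact outer_comm : commr_rmorph (horner_morph inner_comm) 'X_1.
Proof. by move=> c; apply: mulrC. Qed.

HB.instance Definition _ := GRing.RMorphism.copy unbivar (horner_morph outer_comm).

Lemma bivarC (k : F) : bivar k%:MP = k%:P%:P.
Proof. by rewrite /bivar mmapC. Qed.

Lemma bivarX (i : 'I_2) : bivar 'X_i = tnth [tuple 'X%:P; 'X] i.
Proof. by rewrite /bivar mmapX mmap1U. Qed.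

Lemma unbivarC (c : {poly F}) : unbivar c%:P = (map_poly (@mpolyC 2 F) c).['X_0].
Proof. exact: (horner_morphC outer_comm). Qed.

Lemma unbivarX : unbivar 'X = 'X_1.
Proof. exact: (horner_morphX outer_comm). Qed.

Lemma unbivarCC (k : F) : unbivar k%:P%:P = k%:MP.
Proof. by rewrite unbivarC map_polyC hornerC. Qed.

Lemma unbivarCX : unbivar 'X%:P = 'X_0.
Proof. by rewrite unbivarC map_polyX hornerX. Qed.

(** Both maps are ring morphisms, so it suffices to compare scalars and variables. *)
Lemma bivarK : cancel bivar unbivar.
Proof.
elim/mpolyind=> [|c m p _ _ IHp]; first by rewrite !rmorph0.
rewrite !rmorphD /= IHp -mul_mpolyC !rmorphM /= bivarC unbivarCC mpolyXE_id.
rewrite !rmorph_prod /=; congr (_ * _ + _); apply: eq_bigr => i _.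
rewrite !rmorphXn /= bivarX; congr (_ ^+ _).
by case: i => [[|[|//]] lt_i]; rewrite (tnth_nth 0) /= ?unbivarCX ?unbivarX;
  congr 'X_[_]; congr U_(_)%MM; apply: val_inj.
Qed.

Lemma unbivarK : cancel unbivar bivar.
Proof.
elim/poly_ind=> [|P c IHP]; first by rewrite !rmorph0.
rewrite !rmorphD !rmorphM /= IHP unbivarX bivarX (tnth_nth 0) /=.
congr (_ + _); elim/poly_ind: c => [|c k IHc]; first by rewrite !rmorph0.
rewrite !(rmorphD, rmorphM) /= IHc unbivarCX bivarX (tnth_nth 0) /=.
by rewrite unbivarCC bivarC.
Qed.

(** The second coordinate is the outer variable, so [y] is substituted first, as a constant
    polynomial. *)
Lemma bivar_eval p (x y : F) : (bivar p).[y%:P].[x] = p.@[tnth [tuple x; y]].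
Proof.
elim/mpolyind: p => [|c m p _ _ IHp]; first by rewrite !rmorph0 !horner0.
rewrite !rmorphD !hornerD IHp -mul_mpolyC !rmorphM !hornerM /= bivarC.
rewrite mevalC !hornerC mpolyXE_id !rmorph_prod /= !horner_prod; congr (_ * _ + _).
apply: eq_bigr => i _; rewrite !rmorphXn !horner_exp /= bivarX mevalXU.
by case: i => [[|[|//]] lt_i]; rewrite !(tnth_nth 0) /= !hornerE.
Qed.

End BivariateIsomorphism.

(** * Gauss's lemma, primality and the Nullstellensatz in F[x][y] *)

Section BivariatePolynomials.
Variable F : closedFieldType.
Implicit Types (p q r g h : {poly {poly F}}) (c d : {poly F}).

(** Scalars of [F], not arbitrary elements of F[x]: the nonzero ones are the units of F[x][y]. *)
Definition bconst p := exists k : F, p = k%:P%:P.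
Definition bdvd q p := exists r, p = r * q.
Definition birreducible q :=
  ~ bconst q /\ forall a b, q = a * b -> bconst a \/ bconst b.

(** Each coefficient has the root [a], so 'X - a can be divided out coefficientwise. *)
Lemma map_horner_eval_eq0 (a : F) p :
  map_poly (horner_eval a) p = 0 -> exists r, p = ('X - a%:P) *: r.
Proof.
move=> p0; exists (map_poly (fun c => c %/ ('X - a%:P)) p).
apply/polyP=> i; rewrite coefZ coef_map_id0 ?div0p // mulrC divpK //.
rewrite dvdp_XsubCl; apply/rootP.
by have := congr1 (fun p : {poly F} => p`_i) p0; rewrite coef_map coef0.
Qed.

(* Gauss's lemma: since [F] is closed, [c] can be cancelled one linear factor
   ['X - a] at a time, and setting x = a shows that it divides [h] or [g]. *)
Lemma scale_eq_mul c q h g : c != 0 -> c *: q = h * g ->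
  exists c1 c2 h' g',
    [/\ h = c1 *: h', g = c2 *: g', c = c1 * c2 & q = h' * g'].
Proof.
elim: {c}(size c) {-2}c (leqnn (size c)) h g => [|n IHn] c.
  by rewrite leqn0 size_poly_eq0 => ->.
move=> szc h g c0 qE; have [/eqP/size_poly1P[k k0 cE]|] := eqVneq (size c) 1%N.
  have kK : k%:P * k^-1%:P = 1 :> {poly F} by rewrite -polyCM mulfV.
  exists c, 1, (k^-1%:P *: h), g; split; rewrite ?scale1r ?mulr1 //.
    by rewrite cE scalerA kK scale1r.
  by rewrite -scalerAl -qE cE scalerA mulrC kK scale1r.
case/closed_rootP=> a /factor_theorem[c' cE].
have c'0 : c' != 0 by apply: contraNneq c0 => c'0; rewrite cE c'0 mul0r.
have szc' : (size c' <= n)%N.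
  by rewrite -ltnS; move: szc; rewrite cE size_Mmonic ?monicXsubC // size_XsubC addn2.
have XaI : injective (fun p => ('X - a%:P) *: p).
  by move=> p r; rewrite /= -!mul_polyC; apply: mulfI; rewrite polyC_eq0 polyXsubC_eq0.
have ev0 : map_poly (horner_eval a) h * map_poly (horner_eval a) g = 0.
  rewrite -rmorphM -qE /= -mul_polyC rmorphM /= map_polyC /= /horner_eval cE.
  by rewrite hornerM hornerXsubC subrr mulr0 polyC0 mul0r.
have /orP[/eqP|/eqP] : (map_poly (horner_eval a) h == 0)
    || (map_poly (horner_eval a) g == 0) by rewrite -mulf_eq0 ev0.
- case/map_horner_eval_eq0=> h1 hE.
  have E : c' *: q = h1 * g.
    by apply: XaI; rewrite /= scalerA scalerAl -hE mulrC -cE.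
  have [c1 [c2 [h' [g' [h1E -> c'E ->]]]]] := IHn _ szc' _ _ c'0 E.
  exists (('X - a%:P) * c1), c2, h', g'; split=> //.
    by rewrite hE h1E scalerA.
  by rewrite cE c'E mulrC mulrA.
- case/map_horner_eval_eq0=> g1 gE.
  have E : c' *: q = h * g1.
    by apply: XaI; rewrite /= scalerA scalerAr -gE mulrC -cE.
  have [c1 [c2 [h' [g' [-> g1E c'E ->]]]]] := IHn _ szc' _ _ c'0 E.
  exists c1, (('X - a%:P) * c2), h', g'; split=> //.
    by rewrite gE g1E scalerA.
  by rewrite cE c'E mulrC mulrCA.
Qed.

Lemma bconst_size p : bconst p -> (size p <= 1)%N.
Proof. by case=> k ->; exact: size_polyC_leq1. Qed.

(** Irreducibility makes [c1] or [q'] a scalar, and a scalar [q'] would leave [q] of degree 0 in the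
    outer variable. *)
Lemma birreducible_scale_eq q c1 q' : birreducible q -> (1 < size q)%N ->
  q = c1 *: q' -> exists2 k : F, k != 0 & q = k%:P *: q'.
Proof.
move=> [_ irr] szq qE; have [[k kE]|/bconst_size] : bconst c1%:P \/ bconst q'.
- by apply: irr; rewrite mul_polyC.
- exists k; last by rewrite qE; congr (_ *: _); apply: polyC_inj.
  apply: contraTneq szq => k0; rewrite qE -mul_polyC kE k0 !polyC0 mul0r.
  by rewrite size_poly0.
- by move=> sz1; have := leq_trans (size_scale_leq c1 q') sz1; rewrite -qE leqNgt szq.
Qed.

(** Gauss's lemma distributes [c] over the two factors; the share taken from [q] is a nonzero
    scalar, so cancelling it costs only a unit. *)
Lemma bdvd_scale q c p : birreducible q -> (1 < size q)%N -> c != 0 ->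
  bdvd q (c *: p) -> bdvd q p.
Proof.
move=> irr szq c0 [h /(scale_eq_mul c0)[c1 [c2 [h' [q' [_ qE _ ->]]]]]].
have [k k0 ->] := birreducible_scale_eq irr szq qE.
exists (k^-1%:P *: h').
by rewrite -scalerAr -scalerAl scalerA -polyCM mulfV // scale1r.
Qed.

(** If the gcd over F(x) has degree 0 in the outer variable, clearing denominators in Bezout's
    identity gives [d]. Otherwise the gcd is [q] up to a factor from F[x], and [q] would divide
    [p]. *)
Lemma birreducible_Bezout q p : birreducible q -> (1 < size q)%N ->
  ~ bdvd q p -> exists u v d, d != 0 /\ u * q + v * p = d%:P.
Proof.
move=> irr szq ndvd; have q0 : q != 0 by rewrite -size_poly_gt0 ltnW.
have [szg|szg] := leqP (size (gcdp q p)) 1.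
  have /Bezout_coprimepP[[u v] /= ] : coprimep q p.
    by rewrite /coprimep eqn_leq szg size_poly_gt0 gcdp_eq0 negb_and q0.
  by rewrite -size_poly_eq1 => /size_poly1P[d d0 E]; exists u, v, d.
(* Over F[x] the gcd divides [q] and [p] only after scaling by nonzero [c] and [e], which Gauss's
   lemma removes again. *)
have /Pdiv.Idomain.dvdpP[[c h] /= c0 hE] := dvdp_gcdl q p.
have /Pdiv.Idomain.dvdpP[[e l] /= e0 lE] := dvdp_gcdr q p.
case: ndvd; have [c1 [c2 [h' [g' [_ gE _ qE]]]]] := scale_eq_mul c0 hE.
have [[k kE]|/bconst_size sz1] := irr.2 _ _ qE; last first.
  by move: szg; rewrite gE ltnNge (leq_trans (size_scale_leq _ _) sz1).
have k0 : k != 0 by apply: contraNneq q0 => k0; rewrite qE kE k0 !polyC0 mul0r.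
apply: (bdvd_scale irr szq e0); rewrite lE gE qE kE.
exists ((c2 * k^-1%:P) *: l); rewrite mul_polyC -!scalerAr -scalerAl.
by rewrite scalerA mulrCA -polyCM mulfV // mulr1.
Qed.

(* An irreducible polynomial of degree 0 in the outer variable is, up to a unit,
   a linear polynomial in the inner one. *)
Lemma birreducible_size1 q : birreducible q -> (size q <= 1)%N ->
  exists a k : F, k != 0 /\ q = (k *: ('X - a%:P))%:P.
Proof.
move=> [nc irr] /size1_polyC; set c := q`_0 => qE.
have szc : size c != 1%N.
  by apply: contra_notN nc => /size_poly1P[k _ cE]; exists k; rewrite qE cE.
case/closed_rootP: szc => a /factor_theorem[c' cE].
have /irr[[k /polyC_inj kE]|[k /polyC_inj kE]] : q = c'%:P * ('X - a%:P)%:P.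
- by rewrite -polyCM -cE.
- exists a, k; rewrite qE cE kE mul_polyC; split=> //.
  apply: contra_notN nc => /eqP k0; exists 0.
  by rewrite qE cE kE k0 polyC0 mul0r !polyC0.
- by have := size_XsubC a; rewrite kE => sz; have := size_polyC_leq1 k; rewrite sz.
Qed.

Lemma bdvd_XsubC (a k : F) p : k != 0 ->
  bdvd (k *: ('X - a%:P))%:P p <-> map_poly (horner_eval a) p = 0.
Proof.
move=> k0; split=> [[r ->]|/map_horner_eval_eq0[r ->]].
  rewrite rmorphM /= (map_polyC (horner_eval a)) /= /horner_eval.
  by rewrite hornerZ hornerXsubC subrr mulr0 polyC0 mulr0.
exists (k^-1%:P *: r); rewrite mulrC mul_polyC scalerA; congr (_ *: _).
by rewrite mulrC mul_polyC scalerA mulVf // scale1r.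
Qed.

(** For a vertical line, set x = a and use that F[y] is a domain. Otherwise multiply the Bezout
    identity by [r] and cancel [d]. *)
Lemma birreducible_prime q p r : birreducible q ->
  bdvd q (p * r) -> bdvd q p \/ bdvd q r.
Proof.
move=> irr; have [sz1|szq] := leqP (size q) 1.
  have [a [k [k0 ->]]] := birreducible_size1 irr sz1.
  move=> /(bdvd_XsubC _ _ k0); rewrite rmorphM /= => /eqP.
  rewrite mulf_eq0 => /orP[] /eqP E; [left|right]; exact/bdvd_XsubC.
move=> [h hE]; have [|ndvd] := EM (bdvd q p); first by left.
have [u [v [d [d0 E]]]] := birreducible_Bezout irr szq ndvd; right.
apply: (bdvd_scale irr szq d0); exists (u * r + v * h).
by rewrite -mul_polyC -E !mulrDl -!mulrA hE [q * r]mulrC.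
Qed.

Lemma birreducible_nullstellensatz q p : birreducible q ->
  (forall x y : F, q.[y%:P].[x] = 0 -> p.[y%:P].[x] = 0) -> bdvd q p.
Proof.
move=> irr vanish.
have evE (r : {poly {poly F}}) (x y : F) :
    r.[y%:P].[x] = (map_poly (horner_eval x) r).[y].
  by rewrite -[y in RHS](hornerC y x) -/(horner_eval x y%:P) horner_map.
have [sz1|szq] := leqP (size q) 1.
  have [a [k [k0 qE]]] := birreducible_size1 irr sz1.
  (* If p(a, y) were a nonzero polynomial, some [y] would not be a root of it, although [q] vanishes
     on the whole line x = a. *)
  rewrite qE; apply/(bdvd_XsubC _ _ k0)/eqP/negP => /negP/closed_nonrootP[y].
  rewrite /root -evE vanish ?eqxx // qE hornerC hornerZ hornerXsubC subrr.
  by rewrite mulr0.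
have [//|ndvd] := EM (bdvd q p).
have [u [v [d [d0 E]]]] := birreducible_Bezout irr szq ndvd.
have q0 : q != 0 by rewrite -size_poly_gt0 ltnW.
(* Avoiding the roots of [lead_coef q] keeps the degree in y positive after specialization, so a
   root [y] exists there. *)
have /closed_nonrootP[x] : d * lead_coef q != 0 by rewrite mulf_neq0 ?lead_coef_eq0.
rewrite rootM negb_or => /andP[dx lx].
have : size (map_poly (horner_eval x) q) != 1%N.
  by rewrite size_map_poly_id0 // ?neq_ltn ?szq ?orbT.
case/closed_rootP=> y /rootP; rewrite -evE => qxy.
case/rootP: dx; have := congr1 (fun r : {poly {poly F}} => r.[y%:P].[x]) E.
by rewrite !hornerE qxy (vanish _ _ qxy) !mulr0 addr0 => <-.
Qed.

End BivariatePolynomials.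

(** * Transfer to F[x, y] and passage from irreducible to squarefree curves *)

Section PlaneCurves.
Variable F : closedFieldType.
Implicit Types p q r G : {mpoly F[2]}.

Lemma bdvd_bivar q p : bdvd (bivar q) (bivar p) -> mdvd q p.
Proof.
by case=> r E; exists (unbivar r); apply: (can_inj (@bivarK F)); rewrite rmorphM /= unbivarK.
Qed.

Lemma bdvd_bivarW q p : mdvd q p -> bdvd (bivar q) (bivar p).
Proof. by case=> r ->; exists (bivar r); rewrite rmorphM. Qed.

Lemma birreducible_bivar q : mirreducible q -> birreducible (bivar q).
Proof.
move=> [nc irr]; split=> [[k E]|a b E].
  by apply: nc; exists k; apply: (can_inj (@bivarK F)); rewrite bivarC.
have /irr[[k kE]|[k kE]] : q = unbivar a * unbivar b.
- by apply: (can_inj (@bivarK F)); rewrite rmorphM /= !unbivarK.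
- by left; exists k; rewrite -[a]unbivarK kE bivarC.
- by right; exists k; rewrite -[b]unbivarK kE bivarC.
Qed.

Lemma mirreducible_prime q p r : mirreducible q ->
  mdvd q (p * r) -> mdvd q p \/ mdvd q r.
Proof.
move=> /birreducible_bivar irr /bdvd_bivarW; rewrite rmorphM /=.
by move=> /(birreducible_prime irr)[] /bdvd_bivar; [left|right].
Qed.

Lemma mirreducible_nullstellensatz q p : mirreducible q ->
  (forall x y : F, zero_set q [tuple x; y] -> zero_set p [tuple x; y]) ->
  mdvd q p.
Proof.
move=> /birreducible_bivar irr vanish; apply: bdvd_bivar.
apply: birreducible_nullstellensatz irr _ => x y.
by rewrite !bivar_eval; apply: vanish.
Qed.

Lemma mconstP n (p : {mpoly F[n]}) : mconst p <-> (msize p <= 1)%N.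
Proof.
split=> [[c ->]|/msize1_polyC ->]; last by eexists.
by rewrite msizeC leq_b1.
Qed.

(** Induction on the degree: a reducible [p] is a product of two non-constants, each of smaller
    degree. *)
Lemma mirreducible_factor n (p : {mpoly F[n]}) : ~ mconst p ->
  exists2 q, mirreducible q & mdvd q p.
Proof.
elim: {p}(msize p) {-2}p (leqnn (msize p)) => [|m IHm] p szp nc.
  by case: nc; apply/mconstP; apply: leq_trans szp _.
have [irr|red] := EM (mirreducible p).
  by exists p => //; exists 1; rewrite mul1r.
have [a [b [pE [na nb]]]] : exists a b, p = a * b /\ ~ mconst a /\ ~ mconst b.
  apply: contrapT => none; apply: red; split=> // a b pE.
  apply: contrapT => /not_orP[na nb]; apply: none.
  by exists a, b.
have := na; have := nb; rewrite !mconstP => /negP sa /negP sb.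
have sz : (msize a <= m)%N.
  move: sa sb szp; rewrite -!ltnNge pE => sa sb.
  rewrite msizeM; last 2 first.
  - by rewrite -msize_poly_eq0 -lt0n ltnW.
  - by rewrite -msize_poly_eq0 -lt0n ltnW.
  case: (msize b) sa => [//|[//|k]] _; rewrite !addnS /= ltnS.
  exact: leq_trans (leq_addr _ _).
have [q irr [r aE]] := IHm a sz na.
by exists q => //; exists (b * r); rewrite pE aE mulrC mulrA.
Qed.

(* Split off an irreducible factor q: if G = q G' and p = r G', then q divides p,
   hence r or G', and the latter is excluded by squarefreeness. *)
Lemma msquarefree_nullstellensatz G p : G != 0 -> msquarefree G ->
  (forall x y : F, zero_set G [tuple x; y] -> zero_set p [tuple x; y]) ->
  mdvd G p.
Proof.
elim: {G}(msize G) {-2}G (leqnn (msize G)) => [|m IHm] G szG G0 sf vanish.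
  by move: G0; rewrite -msize_poly_eq0 -leqn0 szG.
have [[c GE]|/mirreducible_factor[q irr [r GE]]] := EM (mconst G).
  have c0 : c != 0 by apply: contraNneq G0 => c0; rewrite GE c0 mpolyC0.
  by exists (c^-1 *: p); rewrite GE mulrC mul_mpolyC scalerA mulfV // scale1r.
have [r0 q0] : r != 0 /\ q != 0.
  by split; apply: contraNneq G0 => E; rewrite GE E ?mul0r ?mulr0.
have szr : (msize r <= m)%N.
  have [/mconstP/negP] := irr; rewrite -ltnNge => szq _.
  move: szG; rewrite GE msizeM //.
  case: (msize q) szq => [//|[//|k]] _; rewrite !addnS /= ltnS.
  exact: leq_trans (leq_addr _ _).
have [||h pE] := IHm r szr r0.
- move=> q' irr' [l lE]; apply: (sf q' irr'); exists (q * l).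
  by rewrite GE lE [LHS]mulrC -!mulrA.
- by move=> x y rxy; apply: vanish; rewrite /zero_set GE mevalM rxy mul0r.
have /(mirreducible_prime irr)[[k hE]|[k rE]] : mdvd q (h * r).
- rewrite -pE; apply: mirreducible_nullstellensatz irr _ => x y qxy.
  by apply: vanish; rewrite /zero_set GE mevalM qxy mulr0.
- by exists k; rewrite pE hE GE -mulrA [q * r]mulrC.
- by case: (sf q irr); exists k; rewrite GE rE mulrA.
Qed.

End PlaneCurves.

(* [fintype.liftK] shadows the lifting of [Defs]. *)
Local Notation liftK := Defs.liftK.

HB.instance Definition _ (F : fieldType) :=
  GRing.RMorphism.copy (@liftG F) (comp_mpoly [tuple 'X_0; 'X_1]).

HB.instance Definition _ (F : fieldType) :=
  GRing.RMorphism.copy (@liftK F) (comp_mpoly [tuple 'X_2; 'X_3]).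

(** * Decompositions into products of polynomials in (x, y) and in (s, t), and elimination of
    terms *)

Section Cartesian.
Variable F : closedFieldType.
Implicit Types (P H L : {mpoly F[4]}) (G K a b : {mpoly F[2]}).
Implicit Types (s : seq ({mpoly F[2]} * {mpoly F[2]})).

Lemma liftGZ (c : F) a : liftG (c *: a) = c *: liftG a.
Proof. exact: comp_mpolyZ. Qed.

Lemma liftKZ (c : F) b : liftK (c *: b) = c *: liftK b.
Proof. exact: comp_mpolyZ. Qed.

Lemma liftG_eval a (x y s t : F) :
  (liftG a).@[tnth [tuple x; y; s; t]] = a.@[tnth [tuple x; y]].
Proof.
rewrite /liftG comp_mpoly_meval; apply: meval_eq => -[[|[|//]] lt_i];
  by rewrite !(tnth_nth 0) /= mevalXU (tnth_nth 0).
Qed.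

Lemma liftK_eval b (x y s t : F) :
  (liftK b).@[tnth [tuple x; y; s; t]] = b.@[tnth [tuple s; t]].
Proof.
rewrite /Defs.liftK comp_mpoly_meval; apply: meval_eq => -[[|[|//]] lt_i];
  by rewrite !(tnth_nth 0) /= mevalXU (tnth_nth 0).
Qed.

Lemma liftG_monomial (m n : nat) :
  liftG ('X_0 ^+ m * 'X_1 ^+ n) = 'X_0 ^+ m * 'X_1 ^+ n :> {mpoly F[4]}.
Proof. by rewrite rmorphM !rmorphXn /= /liftG !comp_mpolyXU. Qed.

Lemma liftK_monomial (m n : nat) :
  liftK ('X_0 ^+ m * 'X_1 ^+ n) = 'X_2 ^+ m * 'X_3 ^+ n :> {mpoly F[4]}.
Proof. by rewrite rmorphM !rmorphXn /= /Defs.liftK !comp_mpolyXU. Qed.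

Local Opaque liftG Defs.liftK.

(** The list records one decomposition of an element of F[x, y] ⊗ F[s, t]; its length drives the
    elimination. *)
Definition tensor s : {mpoly F[4]} := \sum_(ab <- s) liftG ab.1 * liftK ab.2.

Lemma tensor_surj P : exists s, P = tensor s.
Proof.
elim/mpolyind: P => [|c m P _ _ [s ->]]; first by exists [::]; rewrite /tensor big_nil.
exists ((c *: ('X_0 ^+ m 0 * 'X_1 ^+ m 1), 'X_0 ^+ m 2 * 'X_1 ^+ m 3) :: s).
rewrite /tensor big_cons; congr (_ + _).
rewrite liftGZ -scalerAl; congr (_ *: _); rewrite liftG_monomial liftK_monomial.
have ord4 : [/\ ord0 = 0 :> 'I_4, lift ord0 ord0 = 1 :> 'I_4,
    lift ord0 (lift ord0 ord0) = 2 :> 'I_4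
  & lift ord0 (lift ord0 (lift ord0 ord0)) = 3 :> 'I_4].
  by split; apply: val_inj.
rewrite mpolyXE_id !big_ord_recl big_ord0 mulr1.
by case: ord4 => -> -> -> ->; rewrite !mulrA.
Qed.

(** The elimination step: once the cofactor of [x] is written through the [g i], its term is
    absorbed by correcting each [f i] by a multiple of [x]. *)
Lemma mul_sub_sum_scale (A : comAlgType F) (T : Type) (s : seq T) (c : T -> F)
    (f g : T -> A) (x u : A) :
  x * (u - \sum_(i <- s) c i *: g i) + \sum_(i <- s) f i * g i
  = \sum_(i <- s) (f i - c i *: x) * g i + x * u.
Proof.
rewrite mulrBr mulr_sumr addrAC -addrA -sumrB addrC; congr (_ + _).
by apply: eq_bigr => i _; rewrite mulrBl -scalerAl -scalerAr.
Qed.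

Lemma mulDr_scale (A : comAlgType F) (c : F) (g h k l x y : A) :
  g * h + k * l + x * (c *: (y * k)) = g * h + k * (l + c *: (x * y)).
Proof. by rewrite mulrDr addrA -!scalerAr [k * (_ * _)]mulrC mulrA. Qed.

(* If the coefficient a of the first term (a, b) does not vanish at a zero v of
   G, specializing at v expresses b modulo K as a combination of the second
   components of the other terms, so that the term can be eliminated;
   otherwise G divides a. *)
Lemma tensor_cartesian G K s : G != 0 -> msquarefree G ->
  (forall x y : F, zero_set G [tuple x; y] ->
     mdvd K (\sum_(ab <- s) ab.1.@[tnth [tuple x; y]] *: ab.2)) ->
  cartesian (tensor s) G K.
Proof.
move=> G0 sf.
elim: {s}(size s) {-2}s (erefl (size s)) => [|n IHn] [|[a b] s] //= sz vanish.
  by exists 0, 0; rewrite /tensor big_nil !mulr0 addr0.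
case: sz => sz; rewrite /tensor big_cons /=.
have [[x [y [Gxy axy]]]|none] :=
    EM (exists x y, zero_set G [tuple x; y] /\ a.@[tnth [tuple x; y]] != 0).
  set v := tnth [tuple x; y] in axy.
  have [h] := vanish x y Gxy; rewrite big_cons /= -/v => bE.
  (* Each first component is corrected by the multiple of [a] that makes it vanish at [v]. *)
  pose al := a.@[v]; pose s' := [seq (ab.1 - (al^-1 * ab.1.@[v]) *: a, ab.2) | ab <- s].
  have bE' : b = al^-1 *: (h * K) - \sum_(ab <- s) (al^-1 * ab.1.@[v]) *: ab.2.
    rewrite -bE scalerDr scalerA mulVf // scale1r scaler_sumr.
    by under [X in _ - X]eq_bigr do rewrite -scalerA; rewrite addrK.
  have tE : liftG a * liftK b + \sum_(ab <- s) liftG ab.1 * liftK ab.2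
      = tensor s' + liftG a * (al^-1 *: (liftK h * liftK K)).
    have sumE : liftK (\sum_(ab <- s) (al^-1 * ab.1.@[v]) *: ab.2)
        = \sum_(ab <- s) (al^-1 * ab.1.@[v]) *: liftK ab.2.
      by rewrite raddf_sum; apply: eq_bigr => ab _; rewrite /= liftKZ.
    rewrite [in LHS]bE' /tensor big_map rmorphB /= sumE liftKZ rmorphM /=.
    rewrite mul_sub_sum_scale; congr (_ + _).
    by apply: eq_bigr => ab _; rewrite rmorphB /= liftGZ.
  rewrite tE; have [||H [L ->]] := IHn s'; first by rewrite size_map.
    move=> x' y' Gxy'; have [h' h'E] := vanish _ _ Gxy'.
    (* At (x', y') the sum for [s'] is the original one, [h' * K], minus a(x', y') times the
       combination at [v] divided by [al], which is [al^-1 *: (h * K)]. *)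
    exists (h' - (a.@[tnth [tuple x'; y']] * al^-1) *: h).
    rewrite mulrBl -h'E big_cons /= -scalerAl [in RHS]bE' scalerBr scalerA.
    rewrite [RHS]addrC !addrA addNr add0r [RHS]addrC big_map scaler_sumr -sumrB.
    by apply: eq_bigr => ab _ /=; rewrite mevalB mevalZ scalerBl scalerA [in RHS]mulrC.
  by exists H, (L + al^-1 *: (liftG a * liftK h)); rewrite mulDr_scale.
have [h aE] : mdvd G a.
  apply: msquarefree_nullstellensatz => // x y Gxy; apply: contrapT => axy.
  by apply: none; exists x, y; split=> //; apply/eqP.
have [//|x y Gxy|H [L E]] := IHn s.
  by have := vanish x y Gxy; rewrite big_cons /= aE mevalM Gxy mulr0 scale0r add0r.
exists (liftG h * liftK b + H), L; rewrite -/(tensor s) E aE rmorphM /= mulrDr addrA.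
by rewrite -!mulrA mulrCA.
Qed.

Lemma vanish_cartesian P G K : G != 0 -> K != 0 -> msquarefree G -> msquarefree K ->
  (forall x y s t : F, zero_set G [tuple x; y] -> zero_set K [tuple s; t] ->
     zero_set P [tuple x; y; s; t]) ->
  cartesian P G K.
Proof.
move=> G0 K0 sfG sfK.
have [s -> vanish] := tensor_surj P; apply: tensor_cartesian => // x y Gxy.
(* With (x, y) frozen at a zero of [G], the sum is a polynomial in (s, t) alone, to which the
   Nullstellensatz for [K] applies. *)
apply: msquarefree_nullstellensatz => // u t Kut.
rewrite /zero_set -[RHS](vanish x y u t Gxy Kut) /tensor 2!raddf_sum /=.
by apply: eq_bigr => ab _; rewrite mevalZ mevalM liftG_eval liftK_eval.
Qed.

Lemma cartesian_vanish P G K (x y s t : F) : cartesian P G K ->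
  zero_set G [tuple x; y] -> zero_set K [tuple s; t] -> zero_set P [tuple x; y; s; t].
Proof.
move=> [H [L ->]] Gxy Kst.
by rewrite /zero_set mevalD !mevalM liftG_eval liftK_eval Gxy Kst !mul0r addr0.
Qed.

End Cartesian.

Theorem theorem2p2 (R : realType) (F : {mpoly R[i][4]}) (G K : {mpoly R[i][2]}) :
  ~ mconst G -> ~ mconst K -> msquarefree G -> msquarefree K ->
  ((forall x y s t : R[i],
       zero_set G [tuple x; y] -> zero_set K [tuple s; t] ->
       zero_set F [tuple x; y; s; t])
   <-> cartesian F G K).
Proof.
have neq0 (p : {mpoly R[i][2]}) : ~ mconst p -> p != 0.
  by move=> nc; apply: contra_notN nc => /eqP ->; exists 0; rewrite mpolyC0.
move=> /neq0 G0 /neq0 K0 sfG sfK; split; first exact: vanish_cartesian.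
by move=> cFGK x y s t; apply: cartesian_vanish cFGK.
Qed.
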